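(* Let $X$ be a real locally convex topological vector space, let $C\subset X$ be a proper closed convex cone, and let $L:X\to X$ be a linear transformation such that $L(C\setminus\{0\})\subseteq C\setminus\{0\}$. Then $$\mathcal{T}(Lx,Ly)\le \tau(L)\,\mathcal{T}(x,y)\qquad \text{for all } x,y\in C\setminus\{0\},$$ where $\tau(L)=\sup_{x,y\in C\setminus\{0\}}\mathcal{T}(Lx,Ly)$ is the diameter of $C$ under $L$ in the $\mathcal{T}$-distance, and $\tau(L)$ equals the Birkhoff contraction coefficient $\tanh\big(\Delta(L)/4\big)$, where $\Delta(L)=\sup_{x,y\in C\setminus\{0\}}\mathcal{H}(Lx,Ly)\in[0,\infty]$.
   Context: A proper closed convex cone $C\subset X$ is a closed set with $C+C\subseteq C$, $\mathbb{R}_+C=C$ and $C\cap(-C)=\{0\}$. For $x,y\in C\setminus\{0\}$ let $\beta(x,y)=\inf\{r>0: rx-y\in C\}\in(0,\infty]$ (with $\inf\emptyset=\infty$). The Hilbert projective pseudo-metric is $\mathcal{H}(x,y)=\log\big(\beta(x,y)\beta(y,x)\big)\in[0,\infty]$, and the $\mathcal{T}$-distance is $\mathcal{T}(x,y)=\tanh\big(\mathcal{H}(x,y)/4\big)\in[0,1]$, with the convention $\tanh(\infty)=1$. *)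

(* Defs.v *)
From mathcomp Require Import all_boot all_order all_algebra.
From mathcomp Require Import all_classical all_reals all_analysis.

Set Implicit Arguments.
Unset Strict Implicit.
Unset Printing Implicit Defensive.

Import Order.TTheory GRing.Theory Num.Theory.

Local Open Scope classical_set_scope.
Local Open Scope ring_scope.

(* [tvsType R] bundles local convexity (a base of convex open sets); it does
   not ask the topology to be Hausdorff. *)
Record proper_closed_convex_cone (R : realType) (X : tvsType R) (C : set X) :
    Prop := ProperClosedConvexCone {
  cone_closed : closed C ;
  cone_addr   : [set x + y | x in C & y in C] `<=` C ;
  cone_scale  : [set r *: x | r in [set r : R | 0 <= r] & x in C] = C ;
  cone_proper : C `&` [set - x | x in C] = [set 0]
}.

Definition tanh (R : realType) (t : R) : R :=
  (expR t - expR (- t)) / (expR t + expR (- t)).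

Definition etanh (R : realType) (t : \bar R) : R :=
  match t with
  | r%:E => tanh r
  | +oo%E => 1
  | -oo%E => -1
  end.

Section HilbertMetric.
Context {R : realType} {X : tvsType R}.
Implicit Types (C : set X) (x y : X) (L : X -> X).

(* [ereal_inf set0 = +oo]. *)
Definition beta C x y : \bar R :=
  ereal_inf [set r%:E | r in [set r : R | 0 < r /\ C (r *: x - y)]].

Definition hilbert_dist C x y : \bar R := lne (beta C x y * beta C y x)%E.

Definition T_dist C x y : R := etanh (hilbert_dist C x y / 4%:E)%E.

(* The values lie in [0, 1], so the real-valued [sup] is the true supremum;
   if [C] is the trivial cone then the set is empty and [sup set0 = 0]. *)
Definition T_diameter C L : R :=
  sup [set T_dist C (L x) (L y) | x in C `\ 0 & y in C `\ 0].

(* Supremum taken in [0, +oo]: the default value 0 (in place of the -oo of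
   [ereal_sup]) is only used for the empty set, i.e. for the trivial cone. *)
Definition hilbert_diameter C L : \bar R :=
  supremum 0%E [set hilbert_dist C (L x) (L y) | x in C `\ 0 & y in C `\ 0].

Definition birkhoff_coefficient C L : R :=
  etanh (hilbert_diameter C L / 4%:E)%E.

End HilbertMetric.

(* Main.v *)
(** Put r = beta(x,y), s = beta(y,x) (attained, since C is closed) and
    u = r x - y, v = s y - x, which lie in C.  If p u' - v' and q v' - u' lie
    in C, where u' = L u and v' = L v, then expanding these two vectors in L x
    and L y gives
      (pr+1) L x - (p+s) L y in C   and   (qs+1) L y - (q+r) L x in C,
    hence bounds on beta(Lx,Ly) and beta(Ly,Lx).  With w^2 = rs and d^2 = pq,
    AM-GM bounds the product of these bounds by ((wd+1)/(w+d))^2.  Since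
    T = (w-1)/(w+1) when exp H = w^2, this reads exactly
    T(Lx,Ly) <= T(Lu,Lv) T(x,y). *)
Require Import Defs.
From mathcomp Require Import all_boot all_order all_algebra.
From mathcomp Require Import all_classical all_reals all_analysis.
From mathcomp Require Import ring lra.

Import Order.TTheory GRing.Theory Num.Theory.

Local Open Scope classical_set_scope.
Local Open Scope ring_scope.

(** * Extended hyperbolic tangent as a Cayley transform *)

Section Tanh.
Context {R : realType}.
Implicit Types (a b t w : R) (h k : \bar R).

(** [(t - 1) / (t + 1)] equals [1 - 2 / (t + 1)], which increases for positive [t]. *)
Lemma le_cayley a b : 0 < a -> 0 < b ->
  ((a - 1) / (a + 1) <= (b - 1) / (b + 1)) = (a <= b).
Proof.
move=> a0 b0; rewrite ler_pdivrMr; last lra.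
rewrite mulrAC ler_pdivlMr; last lra.
by apply/idP/idP; lra.
Qed.

Lemma tanhE t : tanh t = (expR t ^+ 2 - 1) / (expR t ^+ 2 + 1).
Proof.
have e0 := expR_gt0 t.
have e1 : 0 < expR t ^+ 2 by apply: exprn_gt0.
rewrite /tanh expRN; field.
by rewrite !lt0r_neq0// addr_gt0.
Qed.

Lemma tanh_lt1 t : tanh t < 1.
Proof.
have e1 : 0 < expR t ^+ 2 by rewrite exprn_gt0 ?expR_gt0.
by rewrite tanhE ltr_pdivrMr; lra.
Qed.

Lemma tanh_gtN1 t : -1 < tanh t.
Proof.
have e1 : 0 < expR t ^+ 2 by rewrite exprn_gt0 ?expR_gt0.
by rewrite tanhE ltr_pdivlMr; lra.
Qed.

Lemma le_tanh : {mono (@tanh R) : a b / a <= b}.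
Proof.
move=> a b; rewrite !tanhE le_cayley ?exprn_gt0 ?expR_gt0//.
by rewrite ler_pXn2r ?nnegrE ?expR_ge0// ler_expR.
Qed.

Lemma le_etanh : {mono (@etanh R) : h k / (h <= k)%E >-> h <= k}.
Proof.
move=> [a| |] [b| |] //=; rewrite ?lexx ?leey ?leNye ?lee_fin ?le_tanh//.
- exact/ltW/tanh_lt1.
- by apply/negbTE; rewrite -ltNge tanh_gtN1.
- by apply/negbTE; rewrite -ltNge tanh_lt1.
- by apply/negbTE; rewrite -ltNge; lra.
- exact/ltW/tanh_gtN1.
- by lra.
Qed.

Lemma etanh_le1 h : etanh h <= 1.
Proof. by rewrite -[1]/(@etanh R +oo%E) le_etanh leey. Qed.

(** If exp H = w^2 then exp(H/4)^2 = w. Writing the product of the two [beta] values as a square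
    keeps the later estimates rational in [w]. *)
Lemma etanh_lne w : 0 < w ->
  etanh (lne (w ^+ 2)%:E / 4%:E)%E = (w - 1) / (w + 1).
Proof.
move=> w0; rewrite lne_EFin ?exprn_gt0//.
rewrite inver pnatr_eq0 /= tanhE.
suff -> : expR (ln (w ^+ 2) / 4) ^+ 2 = w by [].
rewrite -expRM_natl lnXn// -[ln w *+ 2]mulr_natl.
by rewrite (_ : _ * _ = ln w) ?lnK ?posrE//; field.
Qed.

(** Inverts the Cayley transform by w = (1 + a)/(1 - a); the endpoints come from the infinite
    values. *)
Lemma etanh_surj a : -1 <= a -> a <= 1 -> exists h, etanh h = a.
Proof.
rewrite le_eqVlt => /predU1P[<- _|a1]; first by exists -oo%E.
rewrite le_eqVlt => /predU1P[->|a2]; first by exists +oo%E.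
have w0 : 0 < (1 + a) / (1 - a) by rewrite divr_gt0; lra.
exists (lne (((1 + a) / (1 - a)) ^+ 2)%:E / 4%:E)%E.
by rewrite etanh_lne//; field; lra.
Qed.

End Tanh.

(** * Dominations in a closed cone and the values of T *)

Lemma continuous_affine {R : realType} {X : tvsType R} (x y : X) :
  continuous (fun t : R^o => t *: x - y).
Proof.
move=> t.
apply: (@continuous2_cvg _ _ _ _ _ _ (fun t : R^o => t *: x) (fun=> - y)
  (fun a b : X => a + b) _ _ (@add_continuous X (t *: x, - y))); last exact: cvg_cst.
apply: (@continuous2_cvg _ _ _ _ _ _ (fun t : R^o => t) (fun=> x)
  (fun (a : R^o) (b : X) => a *: b) t x (@scale_continuous R X (t, x))).
- exact: cvg_id.
- exact: cvg_cst.
Qed.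

Section Cone.
Context {R : realType} {X : tvsType R} {C : set X}.
Context (hC : proper_closed_convex_cone C).
Implicit Types (x y : X) (r s w : R).

Lemma coneD x y : C x -> C y -> C (x + y).
Proof. by move=> Cx Cy; apply: (cone_addr hC); exists x => //; exists y. Qed.

Lemma coneZ r x : 0 <= r -> C x -> C (r *: x).
Proof.
by move=> r0 Cx; rewrite -(cone_scale hC); exists r => //; exists x.
Qed.

Lemma cone_divr r s x y : 0 < s -> C (r *: x - s *: y) -> C ((r / s) *: x - y).
Proof.
move=> s0 Crs; rewrite (_ : _ - y = s^-1 *: (r *: x - s *: y)).
  by apply: coneZ => //; rewrite invr_ge0 ltW.
by rewrite scalerBr !scalerA mulVf ?gt_eqF// scale1r mulrC.
Qed.

Lemma cone_opp_eq0 x : C x -> C (- x) -> x = 0.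
Proof.
move=> Cx CNx; suff : [set 0] x by [].
by rewrite -(cone_proper hC); split => //; exists (- x) => //; rewrite opprK.
Qed.

Lemma cone0 : C 0.
Proof.
have : [set 0] (0 : X) by [].
by rewrite -(cone_proper hC) => -[].
Qed.

Lemma beta_ge0 x y : (0 <= beta C x y)%E.
Proof. by apply: le_ereal_inf_tmp => _ [r [/ltW r0 _] <-]; rewrite lee_fin. Qed.

Lemma beta_le r x y : 0 < r -> C (r *: x - y) -> (beta C x y <= r%:E)%E.
Proof. by move=> r0 Cr; apply: ereal_inf_lbound; exists r. Qed.

(** The admissible [t] form a closed set, and the infimum is a limit of them. This includes [r = 0],
    although [beta] ranges over positive numbers only. *)
Lemma beta_attained r x y : beta C x y = r%:E -> C (r *: x - y).
Proof.
move=> br; have : closed ((fun t : R^o => t *: x - y) @^-1` C).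
  apply: closed_comp; last exact: (cone_closed hC).
  by move=> t _; exact: continuous_affine.
move=> /(_ r); apply => B /nbhs_ballP[e /= e0 eB].
have bfin : beta C x y \is a fin_num by rewrite br.
have [_ [t [t0 Ct] <-]] := lb_ereal_inf_adherent e0 bfin.
rewrite -/(beta C x y) br -EFinD lte_fin => tre; exists t; split=> //; apply: eB.
have := beta_le _ _ _ t0 Ct; rewrite br lee_fin => rt.
by rewrite /ball /= distrC ger0_norm; lra.
Qed.

(** An attained value 0 would put [- y] in [C], against properness. *)
Lemma beta_gt0 x y : (C `\ 0) y -> (0 < beta C x y)%E.
Proof.
move=> [Cy y0]; rewrite lt_neqAle beta_ge0 andbT; apply/eqP => b0.
apply: y0; apply: cone_opp_eq0 => //.
by have := beta_attained _ _ _ (esym b0); rewrite scale0r add0r.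
Qed.

(** The sum s(rx - y) + (sy - x) = (rs - 1)x lies in [C]; for rs < 1 so does its opposite, forcing x
    = 0. *)
Lemma dominations_ge1 r s x y : 0 < s -> (C `\ 0) x ->
  C (r *: x - y) -> C (s *: y - x) -> 1 <= r * s.
Proof.
move=> s0 [Cx x0] Cr Cs; rewrite leNgt; apply/negP => rs1.
have C1 : C ((r * s - 1) *: x).
  rewrite (_ : _ *: x = s *: (r *: x - y) + (s *: y - x)).
    by apply: coneD => //; apply: coneZ => //; exact: ltW.
  by rewrite scalerBr scalerA addrA subrK scalerBl scale1r mulrC.
have /eqP : (1 - r * s) *: x = 0.
  apply: cone_opp_eq0; first by apply: coneZ => //; lra.
  by rewrite -scaleNr opprB.
by rewrite scaler_eq0 => /orP[/eqP|/eqP//]; lra.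
Qed.

Lemma T_dist_le r s w x y : 0 < r -> 0 < s -> 0 < w -> r * s <= w ^+ 2 ->
  C (r *: x - y) -> C (s *: y - x) -> T_dist C x y <= (w - 1) / (w + 1).
Proof.
move=> r0 s0 w0 rsw Cr Cs; rewrite -etanh_lne// le_etanh.
apply: lee_wpmul2r; first by rewrite inver pnatr_eq0 /= lee_fin invr_ge0.
rewrite lee_lne ?in_itv /= ?leey ?andbT; last first.
- by rewrite lee_fin exprn_ge0// ltW.
- by rewrite mule_ge0 ?beta_ge0.
apply: (@le_trans _ _ (r * s)%:E); last by rewrite lee_fin.
by rewrite EFinM lee_pmul ?beta_ge0 ?beta_le.
Qed.

Lemma T_distP x y : (C `\ 0) x -> (C `\ 0) y -> T_dist C x y = 1 \/
  exists r s w, [/\ 0 < r /\ 0 < s, C (r *: x - y) /\ C (s *: y - x),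
    1 <= w, w ^+ 2 = r * s & T_dist C x y = (w - 1) / (w + 1)].
Proof.
move=> hx hy; have := beta_gt0 x _ hy; have := beta_gt0 y _ hx.
have oo4 : etanh (+oo / 4%:E)%E = 1 :> R.
  by rewrite inver pnatr_eq0 /= gt0_mulye// lte_fin invr_gt0.
rewrite /T_dist /hilbert_dist.
(* Positivity rules out the product of 0 and +oo, so one infinite factor already gives T = 1. *)
case bxy: (beta C x y) => [r| |]; case byx: (beta C y x) => [s| |] // s0 r0;
  try by left; rewrite ?(gt0_muley r0) ?(gt0_mulye s0).
have Cr := beta_attained _ _ _ bxy; have Cs := beta_attained _ _ _ byx.
move: r0 s0; rewrite !lte_fin => r0 s0.
have rs1 := dominations_ge1 _ _ _ _ s0 hx Cr Cs.
have wE : Num.sqrt (r * s) ^+ 2 = r * s by rewrite sqr_sqrtr; lra.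
right; exists r, s, (Num.sqrt (r * s)); split=> //.
- by rewrite -sqrtr1 ler_sqrt; lra.
- by rewrite -EFinM -[in LHS]wE etanh_lne// sqrtr_gt0; lra.
Qed.

Lemma T_dist_ge0 x y : (C `\ 0) x -> (C `\ 0) y -> 0 <= T_dist C x y.
Proof.
move=> hx hy; have [->//|[r [s [w [_ _ w1 _ ->]]]]] := T_distP _ _ hx hy.
by rewrite divr_ge0; lra.
Qed.

Lemma T_dist_le1 x y : T_dist C x y <= 1.
Proof. exact: etanh_le1. Qed.

(** Handles the degenerate case where rx - y or sy - x vanishes: both dominations hold with zero
    remainder, so w = 1. *)
Lemma T_dist_ray_le0 r x : 0 < r -> T_dist C x (r *: x) <= 0.
Proof.
move=> r0; rewrite (_ : 0 = (1 - 1) / (1 + 1) :> R); last by rewrite subrr mul0r.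
apply: (T_dist_le r r^-1) => //; rewrite ?invr_gt0//.
- by rewrite mulfV ?gt_eqF// expr1n.
- by rewrite subrr; exact: cone0.
- by rewrite scalerA mulVf ?gt_eqF// scale1r subrr; exact: cone0.
Qed.

Lemma T_dist_sym x y : T_dist C x y = T_dist C y x.
Proof. by rewrite /T_dist /hilbert_dist (muleC (beta C x y)). Qed.

End Cone.

(** * Algebra of combined dominations *)

Lemma domination_comb {R : pzRingType} {V : lmodType R} (p r s : R) (x y : V) :
  p *: (r *: x - y) - (s *: y - x) = (p * r + 1) *: x - (p + s) *: y.
Proof.
by rewrite scalerBr scalerA !scalerDl scale1r !opprD opprK [- _ + x]addrC addrACA.
Qed.

(** With n = pr + qs the left side is (w^2 d^2 + 1 + n)/(w^2 + d^2 + n), nonincreasing in n because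
    (w^2 - 1)(d^2 - 1) >= 0. AM-GM gives n >= 2wd, and n = 2wd yields the right side. *)
Lemma domination_product_le {R : realType} (r s w p q d : R) :
  0 < r -> 0 < s -> 0 < p -> 0 < q -> 1 <= w -> 1 <= d ->
  w ^+ 2 = r * s -> d ^+ 2 = p * q ->
  (p * r + 1) / (p + s) * ((q * s + 1) / (q + r)) <=
    ((w * d + 1) / (w + d)) ^+ 2.
Proof.
move=> r0 s0 p0 q0 w1 d1 wE dE.
have N : 2 * (w * d) <= p * r + q * s.
  have pr0 : 0 < p * r by rewrite mulr_gt0.
  have qs0 : 0 < q * s by rewrite mulr_gt0.
  rewrite -(@ler_pXn2r _ 2) ?nnegrE//; try nra.
  rewrite !exprMn wE dE.
  have := sqr_ge0 (p * r - q * s); nra.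
rewrite mulf_div expr_div_n ler_pdivrMr; last by rewrite mulr_gt0 ?addr_gt0.
rewrite mulrAC ler_pdivlMr; last by rewrite exprn_gt0; lra.
(* After clearing denominators, the difference of the two sides is
   (w^2 - 1) (d^2 - 1) (pr + qs - 2wd). *)
have AB : 0 <= (w ^+ 2 - 1) * (d ^+ 2 - 1).
  by rewrite mulr_ge0// subr_ge0 expr_ge1//; lra.
have N0 : 0 <= p * r + q * s - 2 * (w * d) by rewrite subr_ge0.
have := mulr_ge0 AB N0.
have -> : (p * r + 1) * (q * s + 1) = w ^+ 2 * d ^+ 2 + 1 + (p * r + q * s).
  by rewrite wE dE; ring.
have -> : (p + s) * (q + r) = w ^+ 2 + d ^+ 2 + (p * r + q * s).
  by rewrite wE dE; ring.
move: (p * r + q * s) => n; rewrite -subr_ge0 => h; rewrite -subr_ge0.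
by apply: le_trans h _; rewrite le_eqVlt; apply/orP; left; apply/eqP; ring.
Qed.

(** * The contraction inequality and the Birkhoff coefficient *)

Section Contraction.
Context {R : realType} {X : tvsType R} {C : set X} {L : {linear X -> X}}.
Context (hC : proper_closed_convex_cone C).
Context (hL : [set L x | x in C `\ 0] `<=` C `\ 0).
Implicit Types x y : X.

Lemma image_cone_nz x : (C `\ 0) x -> (C `\ 0) (L x).
Proof. by move=> hx; apply: hL; exists x. Qed.

Lemma image_cone x : C x -> C (L x).
Proof.
move=> Cx; have [->|/eqP x0] := eqVneq x 0; first by rewrite linear0; exact: cone0.
by have [] := image_cone_nz x (conj Cx x0).
Qed.

Lemma T_dist_le_diameter x y : (C `\ 0) x -> (C `\ 0) y ->
  T_dist C (L x) (L y) <= T_diameter C L.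
Proof.
move=> hx hy; apply: ub_le_sup; last by exists x => //; exists y.
by exists 1 => _ [a _ [b _ <-]]; exact: T_dist_le1.
Qed.

Lemma linear_domination r x y : L (r *: x - y) = r *: L x - L y.
Proof. by rewrite linearB linearZ. Qed.

Lemma T_dist_contraction x y : (C `\ 0) x -> (C `\ 0) y ->
  T_dist C (L x) (L y) <= T_diameter C L * T_dist C x y.
Proof.
move=> hx hy; have Lxy := T_dist_le_diameter _ _ hx hy.
have [-> //|] := T_distP hC _ _ hx hy; first by rewrite mulr1.
move=> [r [s [w [[r0 s0] [Cu Cv] w1 wE Txy]]]].
have T0 := T_dist_ge0 hC _ _ hx hy.
have tau0 : 0 <= T_diameter C L.
  by apply: le_trans Lxy; apply: T_dist_ge0; try exact: image_cone_nz.
have rhs0 := mulr_ge0 tau0 T0.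
(* If u = 0 then Ly = r Lx, so the left side is at most 0; v = 0 is symmetric. *)
have [u0|/eqP u0] := eqVneq (r *: x - y) 0.
  apply: le_trans rhs0; rewrite -(subr0_eq u0) linearZ /=.
  exact: (T_dist_ray_le0 hC).
have [v0|/eqP v0] := eqVneq (s *: y - x) 0.
  apply: le_trans rhs0; rewrite -(subr0_eq v0) linearZ /= T_dist_sym.
  exact: (T_dist_ray_le0 hC).
have hu := conj Cu u0 : (C `\ 0) _; have hv := conj Cv v0 : (C `\ 0) _.
have Tuv := T_dist_le_diameter _ _ hu hv.
apply: (@le_trans _ _ (T_dist C (L (r *: x - y)) (L (s *: y - x)) * T_dist C x y));
  last exact: ler_wpM2r.
have [->|] := T_distP hC _ _ (image_cone_nz _ hu) (image_cone_nz _ hv).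
  rewrite mul1r Txy; apply: (T_dist_le r s) => //; first lra.
  - by rewrite wE.
  - rewrite -linear_domination; exact: image_cone.
  - rewrite -linear_domination; exact: image_cone.
move=> [p [q [d [[p0 q0] [Cp Cq] d1 dE ->]]]].
rewrite Txy.
have wd0 : 0 < w * d by apply: mulr_gt0; lra.
(* The product of the Cayley transforms of [d] and [w] is that of (wd + 1)/(w + d). *)
rewrite (_ : _ * _ = ((w * d + 1) / (w + d) - 1) / ((w * d + 1) / (w + d) + 1));
  last by field; lra.
move: Cp Cq; rewrite !linear_domination => Cp Cq.
apply: (T_dist_le ((p * r + 1) / (p + s)) ((q * s + 1) / (q + r))).
- by rewrite divr_gt0 ?addr_gt0 ?mulr_gt0.
- by rewrite divr_gt0 ?addr_gt0 ?mulr_gt0.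
- by rewrite divr_gt0; lra.
- exact: domination_product_le.
- by apply: (cone_divr hC); [exact: addr_gt0|rewrite -domination_comb].
- by apply: (cone_divr hC); [exact: addr_gt0|rewrite -domination_comb].
Qed.

(** The map h to [etanh (h / 4)] is an order isomorphism of the extended reals onto [-1, 1], so it
    commutes with nonempty suprema. *)
Lemma T_diameter_birkhoff : T_diameter C L = birkhoff_coefficient C L.
Proof.
rewrite /birkhoff_coefficient /hilbert_diameter.
set H := [set _ | _ in _ & _ in _].
have TE : T_diameter C L = sup [set etanh (h / 4%:E)%E | h in H].
  rewrite /T_diameter; congr sup; apply/seteqP; split.
  - by move=> _ [x hx [y hy <-]]; exists (hilbert_dist C (L x) (L y)) => //;
      exists x => //; exists y.
  - by move=> _ [_ [x hx [y hy <-]] <-]; exists x => //; exists y.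
(* For the trivial cone both default values are 0, and tanh 0 = 0. *)
have [H0|/set0P[h0 Hh0]] := eqVneq H set0.
  rewrite TE H0 image_set0 sup0 supremum0.
  by rewrite mul0e /= tanhE expR0 expr1n subrr mul0r.
have -> : supremum 0%E H = ereal_sup H.
  have Hne : (H == set0) = false by apply/negbTE/set0P; exists h0.
  rewrite /ereal_sup /supremum Hne.
  apply: is_subset1_supremums; apply: xgetPex; exact: ereal_supremums_neq0.
have i4 : (0 < 4%:E^-1 :> \bar R)%E by rewrite inver pnatr_eq0 /= lte_fin invr_gt0.
have ub : has_ubound [set etanh (h / 4%:E)%E | h in H].
  by exists 1 => _ [h _ <-]; exact: etanh_le1.
have tub h : H h -> etanh (h / 4%:E)%E <= T_diameter C L.
  by move=> Hh; rewrite TE; apply: ub_le_sup => //; exists h.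
apply/eqP; rewrite eq_le; apply/andP; split.
  rewrite TE; apply: ge_sup; first by exists (etanh (h0 / 4%:E)%E); exists h0.
  move=> _ [h Hh <-]; rewrite le_etanh; apply: lee_wpmul2r; first exact: ltW.
  exact: ereal_sup_ubound.
(* Pulling the real supremum back to a level [k] reduces the converse to showing that 4k bounds
   [H]. *)
have [k kE] : exists k, etanh k = T_diameter C L.
  apply: etanh_surj.
  - apply: le_trans (tub _ Hh0).
    by rewrite -[-1]/(@etanh R -oo%E) le_etanh leNye.
  - rewrite TE; apply: ge_sup; first by exists (etanh (h0 / 4%:E)%E); exists h0.
    by move=> _ [h _ <-]; exact: etanh_le1.
rewrite -kE le_etanh inver pnatr_eq0 /= lee_pdivrMr//.
apply: ge_ereal_sup => h Hh; rewrite -lee_pdivrMr//.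
by rewrite -le_etanh kE; have := tub h Hh; rewrite inver pnatr_eq0 /=.
Qed.

End Contraction.

Theorem theorem2p6 (R : realType) (X : tvsType R) (C : set X)
    (L : {linear X -> X})
    (hC : proper_closed_convex_cone C)
    (hL : [set L x | x in C `\ 0] `<=` C `\ 0) :
  (forall x y : X, (C `\ 0) x -> (C `\ 0) y ->
     T_dist C (L x) (L y) <= T_diameter C L * T_dist C x y) /\
  T_diameter C L = birkhoff_coefficient C L.
Proof.
split; first exact: T_dist_contraction.
exact: T_diameter_birkhoff.
Qed.
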